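(* Let $\Lambda\in\mathcal H$ be of integral type, $\tilde\Lambda\in\mathcal H$ of $\Lambda$-integral type, and $g\in\mathcal H$ a group-like element. Then $\dim L^g_{\mathcal V_{\tilde\Lambda}}=1$ if $g\in{}_{\tilde\Lambda}\mathcal V$, and $\dim L^g_{\mathcal V_{\tilde\Lambda}}=0$ otherwise. Moreover, if $0\neq\phi\in L^g_{\mathcal V_{\tilde\Lambda}}$, then $\tilde\Lambda$ is non-degenerate (so $\mathcal V_{\tilde\Lambda}=\mathcal A_{\tilde\Lambda}$ is a unital algebra) and $\phi$ is a faithful functional on $\mathcal V_{\tilde\Lambda}$. Conversely, if $\mathcal A_{\tilde\Lambda}$ admits a faithful $g$-cointegral, then $\tilde\Lambda$ is non-degenerate.
   Context: $k$ is a field; $\mathcal H$ is a Hopf algebra over $k$ with comultiplication $\Delta$, counit $\varepsilon$, invertible antipode $S$, dual $\mathcal H'$. A group-like element is a non-zero $g$ with $\Delta(g)=g\otimes g$. For $\Lambda\in\mathcal H$, $\mathcal V_\Lambda=\{(\nu\otimes\mathrm{id})\Delta(\Lambda):\nu\in\mathcal H'\}$ and ${}_\Lambda\mathcal V=\{(\mathrm{id}\otimes\nu)\Delta(\Lambda):\nu\in\mathcal H'\}$. A non-zero $\Lambda$ is of integral type if $\Delta(\Lambda)(1\otimes\Lambda)=\Lambda\otimes\Lambda$; for such $\Lambda$, a non-zero $\tilde\Lambda$ is of $\Lambda$-integral type if $\Delta(\tilde\Lambda)(1\otimes\tilde\Lambda)=\Lambda\otimes\tilde\Lambda$, and it is non-degenerate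 if $1\in\mathcal V_{\tilde\Lambda}$. $\mathcal A_{\tilde\Lambda}=\{a\in\mathcal H:\Delta(a)(1\otimes\tilde\Lambda)=b\otimes\tilde\Lambda\text{ for some }b\in\mathcal H\}$ (a left coideal subalgebra containing $\mathcal V_{\tilde\Lambda}$). For a left coideal $V$ (subspace with $\Delta(V)\subset\mathcal H\otimes V$), a $g$-cointegral on $V$ is $\phi\in V'$ with $(\mathrm{id}\otimes\phi)(\Delta(a))=\phi(a)g$ for all $a\in V$; $L^g_V$ is the space of these. A functional $\omega$ on an algebra $\mathcal B$ is faithful if $\omega(ab)=0$ for all $b\in\mathcal B$ implies $a=0$. *)

(* Defs.v *)
From HB Require Import structures.
From mathcomp Require Import all_boot all_order all_algebra.
Set Implicit Arguments. Unset Strict Implicit. Unset Printing Implicit Defensive.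
Import GRing.Theory.
Local Open Scope ring_scope.

(* An element of H (x) H is represented by a finite list of pairs
   [(x_1,y_1); ...] standing for sum_i x_i (x) y_i.  Two such lists denote the
   same tensor iff all functionals f (x) g, with f g in the full algebraic dual
   H' = {scalar H}, agree on them (H' (x) H' separates H (x) H over a field). *)
Section Tensors.
Variables (K : fieldType) (H : lmodType K).
Definition tens := seq (H * H).
Definition ev2 (f g : {scalar H}) (s : tens) : K := \sum_(p <- s) f p.1 * g p.2.
Definition teq (s t : tens) : Prop := forall f g : {scalar H}, ev2 f g s = ev2 f g t.
Definition slice_l (nu : {scalar H}) (s : tens) : H := \sum_(p <- s) nu p.1 *: p.2.
Definition slice_r (nu : {scalar H}) (s : tens) : H := \sum_(p <- s) nu p.2 *: p.1.
End Tensors.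

Section HopfDef.
Variables (K : fieldType) (H : algType K).
Definition tmul_r (s : tens H) (c : H) : tens H := [seq (p.1, p.2 * c) | p <- s].
Definition tmul (s t : tens H) : tens H :=
  [seq (p.1 * q.1, p.2 * q.2) | p <- s, q <- t].

Record hopf_algebra := HopfAlgebra {
  cop : H -> tens H;
  counit : {scalar H};
  antipode : {linear H -> H};
  cop_add : forall a b, teq (cop (a + b)) (cop a ++ cop b);
  cop_scale : forall (r : K) a, teq (cop (r *: a)) [seq (r *: p.1, p.2) | p <- cop a];
  cop_coassoc : forall a (f g h : {scalar H}),
    \sum_(p <- cop a) ev2 f g (cop p.1) * h p.2 =
    \sum_(p <- cop a) f p.1 * ev2 g h (cop p.2);
  counit_l : forall a, \sum_(p <- cop a) counit p.1 *: p.2 = a;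
  counit_r : forall a, \sum_(p <- cop a) counit p.2 *: p.1 = a;
  cop_mul : forall a b, teq (cop (a * b)) (tmul (cop a) (cop b));
  cop_one : teq (cop 1) [:: (1, 1)];
  counit_mul : forall a b, counit (a * b) = counit a * counit b;
  counit_one : counit 1 = 1;
  antipode_l : forall a, \sum_(p <- cop a) antipode p.1 * p.2 = counit a *: 1;
  antipode_r : forall a, \sum_(p <- cop a) p.1 * antipode p.2 = counit a *: 1;
  antipode_bij : bijective antipode
}.

Variable HH : hopf_algebra.

Definition group_like (g : H) : Prop := g != 0 /\ teq (cop HH g) [:: (g, g)].

Definition VL (L : H) (a : H) : Prop := exists nu : {scalar H}, a = slice_l nu (cop HH L).
Definition LV (L : H) (a : H) : Prop := exists nu : {scalar H}, a = slice_r nu (cop HH L).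

Definition integral_type (L : H) : Prop :=
  L != 0 /\ teq (tmul_r (cop HH L) L) [:: (L, L)].
Definition Lintegral_type (L Lt : H) : Prop :=
  Lt != 0 /\ teq (tmul_r (cop HH Lt) Lt) [:: (L, Lt)].
Definition non_degenerate_integral (Lt : H) : Prop := VL Lt 1.

Definition AL (Lt : H) (a : H) : Prop :=
  exists b : H, teq (tmul_r (cop HH a) Lt) [:: (b, Lt)].

(* phi (a functional on H, i.e. an extension of a functional on V) is a
   g-cointegral on the left coideal V *)
Definition cointegral (V : H -> Prop) (g : H) (phi : {scalar H}) : Prop :=
  forall a, V a -> slice_r phi (cop HH a) = phi a *: g.

Definition nonzero_on (V : H -> Prop) (phi : {scalar H}) : Prop :=
  exists a, V a /\ phi a != 0.

Definition faithful_on (V : H -> Prop) (phi : {scalar H}) : Prop :=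
  forall a, V a -> (forall b, V b -> phi (a * b) = 0) -> a = 0.
End HopfDef.

(* Main.v *)
Require Import Defs.
From HB Require Import structures.
From mathcomp Require Import all_boot all_order all_algebra.
From mathcomp Require boolp classical_sets.
Import GRing.Theory.
Local Open Scope ring_scope.
Set Implicit Arguments. Unset Strict Implicit. Unset Printing Implicit Defensive.

(** For a in A write b for the element with D(a)(1 (x) Lt) = b (x) Lt. The
    antipode gives (1 (x) a) D(Lt) = (S(b) (x) 1) D(Lt), so A V is contained in
    V, and nu(Lt) a = sum nu(S(b_2) Lt) b_1, so a |-> b is injective. A
    g-cointegral phi on V satisfies (id (x) phi) D(Lt) = phi(Lt) g, hence
    phi(v) = phi(Lt) mu(g) for v = (mu (x) id) D(Lt); this settles the dimension
    of the space of cointegrals. Moreover phi(a v) = phi(Lt) mu(S(b) g) for a in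
    A, so phi(a V) = 0 forces a = 0 when phi(Lt) <> 0. As V is finite
    dimensional, phi is then represented on V by some v in V, that is
    phi(v x) = phi(x); now v - 1 lies in A and phi((v - 1) V) = 0, so v = 1.

    For the converse, A acts faithfully on V by left multiplication, so A is
    finite dimensional and a left nondegenerate form phi(x y) on A is also right
    nondegenerate. Since A V is contained in V, phi cannot vanish on V. *)

(** * Linear functionals on a space of arbitrary dimension *)

Section Functionals.
Variables (K : fieldType) (H : lmodType K).

Definition scalar_of (f : H -> K) (lf : scalar f) : {scalar H} :=
  HB.pack f (GRing.isLinear.Build K H K _ f lf).

Lemma scalar_ofE (f : H -> K) (lf : scalar f) : scalar_of lf =1 f.
Proof. by []. Qed.

Definition subspace (V : H -> Prop) : Prop :=
  V 0 /\ forall (k : K) y z, V y -> V z -> V (k *: y + z).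

Lemma subspaceZ V k y : subspace V -> V y -> V (k *: y).
Proof. by case=> V0 Vl Vy; rewrite -[_ *: y]addr0; apply: Vl. Qed.

Lemma subspaceB V y z : subspace V -> V y -> V z -> V (y - z).
Proof. by case=> V0 Vl Vy Vz; rewrite addrC -scaleN1r; apply: Vl. Qed.

Lemma subspace_sum V (I : Type) (r : seq I) (k : I -> K) (e : I -> H) :
  subspace V -> (forall i, V (e i)) -> V (\sum_(i <- r) k i *: e i).
Proof.
move=> [V0 Vl] Ve; elim: r => [|i r IHr]; first by rewrite big_nil.
by rewrite big_cons; apply: Vl.
Qed.

(** Zorn's lemma gives [W] maximal among the subspaces that contain [V] and miss [x]; such a [W] is
    a hyperplane complementary to the line of [x]. *)
Lemma maximal_avoiding_subspace (V : H -> Prop) (x : H) :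
  subspace V -> ~ V x ->
  exists W, [/\ subspace W, forall y, V y -> W y, ~ W x &
                forall y, exists c, W (y - c *: x)].
Proof.
move=> Vs Vx; have [V0 Vl] := Vs.
(* the empty set is admitted so that the union of the empty chain qualifies *)
pose P (W : classical_sets.set H) :=
  [/\ forall (k : K) y z, W y -> W z -> W (k *: y + z), ~ W x &
      forall w, W w -> forall y, V y -> W y].
have [|W [[Wl Wx WV] Wmax]] := @classical_sets.Zorn_bigcup _ P.
  move=> F FP Ftot; split.
  - move=> k y z [A FA Ay] [B FB Bz].
    have [AB|BA] := Ftot _ _ FA FB.
      by exists B => //; case: (FP _ FB) => Bl _ _; apply: Bl => //; apply: AB.
    by exists A => //; case: (FP _ FA) => Al _ _; apply: Al => //; apply: BA.
  - by case=> A FA Ax; case: (FP _ FA).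
  by move=> w [A FA Aw] y Vy; exists A => //; case: (FP _ FA) => _ _ /(_ w Aw); apply.
have {}WV y : V y -> W y.
  move=> Vy; case: (boolp.pselect (exists w, W w)) => [[w Ww]|W0].
    exact: WV Ww _ Vy.
  have /Wmax[] : classical_sets.proper W V.
    by split=> [w Ww|VW]; case: W0; [exists w | exists 0; apply: VW].
  by split.
have Ws : subspace W by split; [apply: WV | apply: Wl].
exists W; split=> // y.
case: (boolp.pselect (W y)) => [Wy|nWy]; first by exists 0; rewrite scale0r subr0.
(* [B] is the span of [W] and [y]. By maximality it violates [P], which can only happen because [x]
   lies in [B]; solving that relation for [y] gives the coefficient. *)
pose B : classical_sets.set H := fun z => exists k : K, W (z - k *: y).
have /boolp.not_and3P : ~ P B.
  apply: Wmax; split; first by move=> z Wz; exists 0; rewrite scale0r subr0.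
  by move=> BW; apply/nWy/BW; exists 1; rewrite scale1r subrr; apply: WV.
have Bl k z1 z2 : B z1 -> B z2 -> B (k *: z1 + z2).
  move=> [k1 W1] [k2 W2]; exists (k * k1 + k2).
  have -> : k *: z1 + z2 - (k * k1 + k2) *: y
      = k *: (z1 - k1 *: y) + (z2 - k2 *: y).
    by rewrite scalerBr scalerDl scalerA opprD addrACA.
  exact: Wl.
case=> [/(_ Bl)//|/boolp.contrapT [k Wk]|[]]; last first.
  by move=> w _ z Vz; exists 0; rewrite scale0r subr0; apply: WV.
have k0 : k != 0.
  by apply/eqP => k0; apply: Wx; rewrite k0 scale0r subr0 in Wk.
exists k^-1.
have -> : y - k^-1 *: x = - k^-1 *: (x - k *: y).
  by rewrite scalerBr scalerA mulNr mulVf // scaleN1r opprK addrC scaleNr.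
exact: subspaceZ.
Qed.

(** The functional reads off the coefficient of [x] modulo the hyperplane [W]; uniqueness of this
    coefficient makes it linear. *)
Lemma separating_functional (V : H -> Prop) (x : H) :
  subspace V -> ~ V x ->
  exists f : {scalar H}, (forall y, V y -> f y = 0) /\ f x = 1.
Proof.
move=> Vs Vx; have [W [Ws VW Wx Wc]] := maximal_avoiding_subspace Vs Vx.
have [f fP] := boolp.choice Wc.
have uniq_c y c : W (y - c *: x) -> f y = c.
  move=> Wyc; apply/eqP; rewrite -subr_eq0; apply/negP => /negP fc.
  apply: Wx; rewrite -(scale1r x) -(mulVf fc) -scalerA.
  apply: subspaceZ => //.
  have -> : (f y - c) *: x = (y - c *: x) - (y - f y *: x).
    by rewrite opprB [RHS]addrC subrKA scalerBl.
  exact: subspaceB.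
have lf : scalar f.
  move=> k y z; apply: uniq_c.
  have -> : k *: y + z - (k * f y + f z) *: x
      = k *: (y - f y *: x) + (z - f z *: x).
    by rewrite scalerBr scalerDl scalerA opprD addrACA.
  by case: Ws => _; apply.
exists (scalar_of lf); split=> [y Vy|]; rewrite scalar_ofE; apply: uniq_c.
  by rewrite scale0r subr0; apply: VW.
by rewrite scale1r subrr; case: Ws.
Qed.

Lemma exists_functional1 (x : H) : x != 0 -> exists f : {scalar H}, f x = 1.
Proof.
move=> /eqP x0; have [||f [_ fx]] := @separating_functional (fun y => y = 0) x.
- by split=> // k y z -> ->; rewrite scaler0 addr0.
- exact: x0.
by exists f.
Qed.

(** Finite-rank substitute for a basis of [H]. When the current expansion [P] does not fix the next
    [x], add the pair [(f, x - P x)], where [f] vanishes on the fixed points of [P] and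
    [f x = 1]. *)
Lemma dual_basis (X : seq H) :
  exists D : seq ({scalar H} * H),
    forall x, x \in X -> x = \sum_(d <- D) d.1 x *: d.2.
Proof.
elim: X => [|x X [D DP]]; first by exists [::].
pose P y := \sum_(d <- D) d.1 y *: d.2.
have Pl k y z : P (k *: y + z) = k *: P y + P z.
  rewrite /P scaler_sumr -big_split; apply: eq_bigr => d _ /=.
  by rewrite linearP scalerDl scalerA.
pose V y := P y = y.
have Vs : subspace V.
  split; last by move=> k y z Vy Vz; rewrite /V Pl Vy Vz.
  by rewrite /V /P big1 // => d _; rewrite linear0 scale0r.
case: (boolp.pselect (V x)) => [Vx|Vx].
  by exists D => y /[!inE] /predU1P [->|/DP//]; rewrite -[LHS]Vx.
have [f [fV fx]] := separating_functional Vs Vx.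
exists ((f, x - P x) :: D) => y /[!inE] /predU1P [->|yX].
  by rewrite big_cons fx scale1r -/(P x) subrK.
by rewrite big_cons /= fV ?scale0r ?add0r; [apply: DP | rewrite /V [RHS]DP].
Qed.

Lemma functionals_separate (x y : H) : (forall f : {scalar H}, f x = f y) -> x = y.
Proof.
move=> fxy; have [D DP] := dual_basis [:: x; y].
have /DP-> : x \in [:: x; y] by rewrite inE eqxx.
have /DP yD : y \in [:: x; y] by rewrite !inE eqxx orbT.
by rewrite [RHS]yD; apply: eq_bigr => d _; rewrite fxy.
Qed.

End Functionals.

(** * Multilinear maps evaluated on representatives of tensors *)

Section Multilinear.
Variables (K : fieldType) (H M : lmodType K).

(** Values lie in an arbitrary module, so that scalar forms (taken in [K^o]) and vector-valued
    Sweedler sums share the same lemmas. *)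
Definition bilin (F : H -> H -> M) : Prop :=
  (forall y, linear (F^~ y)) /\ (forall x, linear (F x)).

Definition trilin (F : H -> H -> H -> M) : Prop :=
  [/\ forall y z, linear (fun x => F x y z), forall x z, linear (fun y => F x y z)
    & forall x y, linear (F x y)].

Lemma lin0 (f : H -> M) : linear f -> f 0 = 0.
Proof. by move=> lf; have := lf (-1) 0 0; rewrite scaler0 addr0 scaleN1r addNr. Qed.

Lemma linZ (f : H -> M) k x : linear f -> f (k *: x) = k *: f x.
Proof. by move=> lf; rewrite -[k *: x]addr0 lf (lin0 lf) addr0. Qed.

Lemma lin_sum (f : H -> M) (I : Type) (r : seq I) (e : I -> H) :
  linear f -> f (\sum_(i <- r) e i) = \sum_(i <- r) f (e i).
Proof.
move=> lf; elim: r => [|i r IHr]; first by rewrite !big_nil lin0.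
by rewrite !big_cons -[e i]scale1r lf IHr !scale1r.
Qed.

Lemma lin_sumZ (f : H -> M) (I : Type) (r : seq I) (k : I -> K) (e : I -> H) :
  linear f -> f (\sum_(i <- r) k i *: e i) = \sum_(i <- r) k i *: f (e i).
Proof.
by move=> lf; rewrite (lin_sum _ _ lf); apply: eq_bigr => i _; rewrite linZ.
Qed.

(** Expanding both legs in a dual basis for the finitely many entries leaves only values of [ev2],
    on which [s] and [t] agree. This is the universal property of the tensor product. *)
Lemma teq_bilin (F : H -> H -> M) (s t : tens H) : bilin F -> teq s t ->
  \sum_(p <- s) F p.1 p.2 = \sum_(p <- t) F p.1 p.2.
Proof.
move=> [F1 F2] st.
have [D DP] := dual_basis ([seq p.1 | p <- s ++ t] ++ [seq p.2 | p <- s ++ t]).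
have FE u : {subset u <= s ++ t} -> \sum_(p <- u) F p.1 p.2 =
    \sum_(c <- D) \sum_(d <- D) ev2 c.1 d.1 u *: F c.2 d.2.
  move=> us; under [RHS]eq_bigr do
    under eq_bigr do rewrite /ev2 scaler_suml.
  under [RHS]eq_bigr do rewrite exchange_big /=.
  rewrite exchange_big /=; apply: eq_big_seq => p pu.
  rewrite {1}(DP p.1) ?mem_cat ?(map_f _ (us _ pu)) // (lin_sumZ _ _ _ (F1 _)).
  apply: eq_bigr => c _.
  rewrite {1}(DP p.2) ?mem_cat ?(map_f _ (us _ pu)) ?orbT //.
  rewrite (lin_sumZ _ _ _ (F2 _)) scaler_sumr.
  by apply: eq_bigr => d _; rewrite scalerA.
rewrite !FE; first by apply: eq_bigr => c _; apply: eq_bigr => d _; rewrite st.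
  by move=> p; rewrite mem_cat orbC => ->.
by move=> p; rewrite mem_cat => ->.
Qed.

Lemma trilin_ext (F : H -> H -> H -> M) (s t : seq (H * H * H)) : trilin F ->
  (forall f g h : {scalar H}, \sum_(p <- s) f p.1.1 * g p.1.2 * h p.2 =
                              \sum_(p <- t) f p.1.1 * g p.1.2 * h p.2) ->
  \sum_(p <- s) F p.1.1 p.1.2 p.2 = \sum_(p <- t) F p.1.1 p.1.2 p.2.
Proof.
move=> [F1 F2 F3] st.
have [D DP] := dual_basis ([seq p.1.1 | p <- s ++ t] ++
  [seq p.1.2 | p <- s ++ t] ++ [seq p.2 | p <- s ++ t]).
have FE u : {subset u <= s ++ t} -> \sum_(p <- u) F p.1.1 p.1.2 p.2 =
    \sum_(b <- D) \sum_(c <- D) \sum_(d <- D)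
      (\sum_(p <- u) b.1 p.1.1 * c.1 p.1.2 * d.1 p.2) *: F b.2 c.2 d.2.
  move=> us; under [RHS]eq_bigr do
    (under eq_bigr do
      (under eq_bigr do rewrite scaler_suml; rewrite exchange_big /=);
     rewrite exchange_big /=).
  rewrite exchange_big /=; apply: eq_big_seq => p pu.
  rewrite {1}(DP p.1.1) ?mem_cat ?(map_f (fun q => q.1.1) (us _ pu)) //.
  rewrite (lin_sumZ _ _ _ (F1 _ _)); apply: eq_bigr => b _.
  rewrite {1}(DP p.1.2) ?mem_cat ?(map_f (fun q => q.1.2) (us _ pu)) ?orbT //.
  rewrite (lin_sumZ _ _ _ (F2 _ _)) scaler_sumr; apply: eq_bigr => c _.
  rewrite {1}(DP p.2) ?mem_cat ?(map_f _ (us _ pu)) ?orbT //.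
  rewrite (lin_sumZ _ _ _ (F3 _ _)) !scaler_sumr.
  by apply: eq_bigr => d _; rewrite !scalerA.
rewrite !FE.
- by do 3!(apply: eq_bigr => ? _); rewrite st.
- by move=> p; rewrite mem_cat orbC => ->.
by move=> p; rewrite mem_cat => ->.
Qed.

End Multilinear.

(** * Finite-dimensional subspaces and nondegenerate forms on them *)

Section FiniteDimension.
Variables (K : fieldType) (H : lmodType K).

Definition comb m (e : 'I_m -> H) (x : 'rV[K]_m) := \sum_i x 0 i *: e i.

Definition free_family m (e : 'I_m -> H) := forall x, comb e x = 0 -> x = 0.

(** A dimension bound is expressed by the dependence of all longer families, so that no basis has to
    be chosen beforehand. *)
Definition dim_le (V : H -> Prop) n := forall m (e : 'I_m -> H), (n < m)%N ->
  (forall i, V (e i)) -> exists2 x, x != 0 & comb e x = 0.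

Lemma wide_kernel m n (X : 'M[K]_(m, n)) :
  (n < m)%N -> exists2 x : 'rV_m, x != 0 & x *m X = 0.
Proof.
move=> nm; have /rowV0Pn [x /sub_kermxP xX x0] : kermx X != 0.
  rewrite kermx_eq0 /row_free; apply/eqP => rX.
  by have := rank_leq_col X; rewrite rX leqNgt nm.
by exists x.
Qed.

Lemma span_dim_le (V : H -> Prop) n (u : 'I_n -> H) :
  (forall v, V v -> exists c, v = comb u c) -> dim_le V n.
Proof.
move=> Vu m e nm Ve.
have [c ec] := boolp.choice (fun i => Vu _ (Ve i)).
have [x x0 xc] := wide_kernel (\matrix_(i < m) c i) nm.
exists x => //; rewrite /comb; under eq_bigr do rewrite ec /comb scaler_sumr.
rewrite exchange_big big1 // => j _; under eq_bigr do rewrite scalerA.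
rewrite -scaler_suml [X in X *: _](_ : _ = 0) ?scale0r //.
have /matrixP/(_ 0 j) := xc; rewrite !mxE => xcj; rewrite -[RHS]xcj.
by apply: eq_bigr => i _; rewrite mxE.
Qed.

(** A free family in [V] of maximal length, which is at most [n], spans. *)
Lemma exists_basis (V : H -> Prop) n : subspace V -> dim_le V n ->
  exists r (e : 'I_r -> H), [/\ forall i, V (e i), free_family e &
    forall v, V v -> exists c, v = comb e c].
Proof.
move=> Vs Vn.
pose P m := boolp.asbool (exists e : 'I_m -> H, (forall i, V (e i)) /\ free_family e).
have exP : exists m, P m.
  exists 0%N; apply/boolp.asboolP; exists (fun=> 0).
  by split=> [[]//|x _]; apply/rowP => -[].
have leP m : P m -> (m <= n)%N.
  move=> /boolp.asboolP [e [Ve fe]]; rewrite leqNgt; apply/negP => nm.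
  by have [x /eqP x0 /fe] := Vn _ _ nm Ve.
case: (ex_maxnP exP leP) => r /boolp.asboolP [e [Ve fe]] rmax.
exists r, e; split=> // v Vv.
(* [v] is put in front of [e]. The longer family is dependent, and freeness of [e] makes the
   coefficient of [v] in the relation non-zero. *)
pose e' (i : 'I_r.+1) := oapp e v (unlift ord0 i).
have /boolp.asboolP : ~~ P r.+1 by apply/negP => /rmax; rewrite ltnn.
have Ve' i : V (e' i) by rewrite /e'; case: unlift.
have combE x : comb e' x = x 0 ord0 *: v + comb e (\row_i x 0 (lift ord0 i)).
  rewrite /comb big_ord_recl /e' unlift_none; congr (_ + _).
  by apply: eq_bigr => i _; rewrite liftK mxE.
move=> nfe; have [x [x0 xe]] : exists x, x != 0 /\ comb e' x = 0.
  apply: boolp.contrapT => nx; apply: nfe; exists e'; split=> // x xe.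
  by apply/eqP/negP => /negP x0; apply: nx; exists x.
rewrite combE in xe.
have xv : x 0 ord0 != 0.
  apply: contraNneq x0 => x00; rewrite x00 scale0r add0r in xe.
  apply/eqP/rowP => i; rewrite mxE; case: (unliftP ord0 i) => [j|] -> //.
  by have /fe/rowP/(_ j) := xe; rewrite !mxE.
exists (- (x 0 ord0)^-1 *: \row_i x 0 (lift ord0 i)).
transitivity (- (x 0 ord0)^-1 *: comb e (\row_i x 0 (lift ord0 i))).
  move/eqP: xe; rewrite addrC addr_eq0 => /eqP ->.
  by rewrite scalerN scaleNr opprK scalerA mulVf // scale1r.
by rewrite /comb scaler_sumr; apply: eq_bigr => i _; rewrite [in RHS]mxE scalerA.
Qed.

Section Gram.
Variables (V : H -> Prop) (n : nat) (B : H -> H -> K^o).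
Hypotheses (Vs : subspace V) (Vn : dim_le V n) (bB : bilin B).
Hypothesis Bl : forall a, V a -> (forall b, V b -> B a b = 0) -> a = 0.

(** Left nondegeneracy says that no non-zero row vector kills the Gram matrix; being square, the
    matrix is then invertible. This is what turns left nondegeneracy into right nondegeneracy. *)
Lemma gram_unit : exists r (e : 'I_r -> H),
  [/\ forall i, V (e i), forall v, V v -> exists c, v = comb e c &
      \matrix_(i, j) B (e i) (e j) \in unitmx].
Proof.
have [r [e [Ve fe es]]] := exists_basis Vs Vn.
exists r, e; split=> //; set G := \matrix_(i, j) _.
have xG0 (x : 'rV_r) : x *m G = 0 -> x = 0.
  move=> xG; apply: fe; apply: Bl; first by rewrite /comb; apply: subspace_sum.
  move=> b /es [c ->]; rewrite (lin_sumZ _ _ _ (proj2 bB _)) big1 // => j _.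
  have -> : B (comb e x) (e j) = (x *m G) 0 j; last by rewrite xG mxE scaler0.
  rewrite (lin_sumZ _ _ _ (proj1 bB _)) mxE.
  by apply: eq_bigr => i _; rewrite [in RHS]mxE.
rewrite -row_free_unit -kermx_eq0; apply/eqP/row_matrixP => k; rewrite row0.
by apply/xG0/sub_kermxP/row_sub.
Qed.

Lemma right_nondegenerate z : V z -> (forall a, V a -> B a z = 0) -> z = 0.
Proof.
have [r [e [Ve es Gu]]] := gram_unit; move=> /es [c ->] Bz.
suff -> : c = 0 by rewrite /comb big1 // => i _; rewrite mxE scale0r.
apply/trmx_inj; rewrite trmx0 -[c^T](mulKmx Gu).
set X := _ *m c^T; suff -> : X = 0 by rewrite mulmx0.
apply/colP => i; rewrite !mxE -[RHS](Bz _ (Ve i)) (lin_sumZ _ _ _ (proj2 bB _)).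
by apply: eq_bigr => j _; rewrite !mxE mulrC.
Qed.

Lemma functional_represented (f : {scalar H}) :
  exists2 v, V v & forall x, V x -> B v x = f x.
Proof.
have [r [e [Ve es Gu]]] := gram_unit.
(* [y] solves [y *m G = (f (e j))_j], so its combination represents [f] on each [e j]. *)
set G := \matrix_(i, j) _ in Gu; pose y := (\row_j f (e j)) *m invmx G.
have yG j : f (e j) = (y *m G) 0 j by rewrite mulmxKV // mxE.
exists (comb e y); first by rewrite /comb; apply: subspace_sum.
move=> x /es [c ->]; rewrite (lin_sumZ _ _ _ (proj2 bB _)).
rewrite [in RHS]/comb linear_sum; apply: eq_bigr => j _; rewrite linearZ yG mxE.
congr (_ * _); rewrite (lin_sumZ _ _ _ (proj1 bB _)).
by apply: eq_bigr => i _; rewrite [G i j]mxE.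
Qed.

End Gram.
End FiniteDimension.

(** * Linearity of expressions built from Sweedler sums *)

Section LinearMaps.
Variables (K : fieldType) (H : algType K) (HH : hopf_algebra H).
Local Notation D := (cop HH).

Lemma linear_comp_linear (U V : lmodType K) (h : {linear U -> V}) (W : lmodType K)
  (f : W -> U) : linear f -> linear (fun x => h (f x)).
Proof. by move=> lf k x y; rewrite lf linearP. Qed.

Lemma linear_functional (h : {scalar H}) (W : lmodType K) (f : W -> H) :
  linear f -> linear (fun x => h (f x) : K^o).
Proof. by move=> lf k x y; rewrite lf linearP. Qed.

Lemma linear_mull (W : lmodType K) (a : H) (f : W -> H) :
  linear f -> linear (fun x => a * f x).
Proof. by move=> lf k x y; rewrite lf mulrDr scalerAr. Qed.

Lemma linear_mulr (W : lmodType K) (a : H) (f : W -> H) :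
  linear f -> linear (fun x => f x * a).
Proof. by move=> lf k x y; rewrite lf mulrDl scalerAl. Qed.

Lemma linear_scale (M W : lmodType K) (a : K) (f : W -> M) :
  linear f -> linear (fun x => a *: f x).
Proof. by move=> lf k x y; rewrite lf scalerDr !scalerA mulrC. Qed.

Lemma linear_scalel (M W : lmodType K) (m : M) (f : W -> K^o) :
  linear f -> linear (fun x => f x *: m).
Proof. by move=> lf k x y; rewrite lf scalerDl scalerA. Qed.

Lemma linear_bigsum (M W : lmodType K) (I : Type) (r : seq I) (f : I -> W -> M) :
  (forall i, linear (f i)) -> linear (fun x => \sum_(i <- r) f i x).
Proof.
move=> lf k x y; rewrite scaler_sumr -big_split.
by apply: eq_bigr => i _; rewrite lf.
Qed.

(** The coproduct is linear only up to [teq], so the sum over its entries is linear by way of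
    [teq_bilin]. *)
Lemma linear_cop (M W : lmodType K) (G : H * H -> M) (f : W -> H) :
  (forall y, linear (fun x => G (x, y))) -> (forall x, linear (fun y => G (x, y))) ->
  linear f -> linear (fun x => \sum_(p <- D (f x)) G p).
Proof.
move=> G1 G2 lf k x y; have bG : bilin (fun x y => G (x, y)) by [].
have GE s : \sum_(p <- s) G p = \sum_(p <- s) G (p.1, p.2).
  by apply: eq_bigr => -[].
rewrite !GE lf (teq_bilin bG (cop_add _ _ _)) big_cat (teq_bilin bG (cop_scale _ _ _)).
rewrite big_map scaler_sumr /=; congr (_ + _).
by apply: eq_bigr => p _; rewrite (linZ _ _ (G1 p.2)).
Qed.

Lemma linear_id (W : lmodType K) : linear (fun x : W => x).
Proof. by []. Qed.

Lemma linear_bilinl (M W : lmodType K) (F : H -> H -> M) y (f : W -> H) :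
  bilin F -> linear f -> linear (fun x => F (f x) y).
Proof. by case=> F1 _ lf k u v; rewrite lf F1. Qed.

Lemma linear_bilinr (M W : lmodType K) (F : H -> H -> M) y (f : W -> H) :
  bilin F -> linear f -> linear (fun x => F y (f x)).
Proof. by case=> _ F2 lf k u v; rewrite lf F2. Qed.

End LinearMaps.

(** Linearity side conditions are settled by peeling off the outer operations until the bare
    variable remains; [mlin] does this for each argument of a multilinear map. *)
Ltac lin_step := first
  [ apply: linear_id | apply: linear_functional
  | match goal with bF : bilin ?F |- _ =>
      first [apply: (linear_bilinl _ bF) | apply: (linear_bilinr _ bF)] end
  | apply: linear_bigsum => ? | apply: linear_cop => [?|?|] /=
  | apply: linear_mull | apply: linear_mulr
  | apply: linear_scale | apply: linear_scalel | apply: linear_comp_linear ].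
Ltac lin := repeat lin_step.
Ltac mlin := split => * /=; lin.

(** * Sweedler calculus in a Hopf algebra *)

Section Hopf.
Variables (K : fieldType) (H : algType K) (HH : hopf_algebra H).
Local Notation D := (cop HH).
Local Notation S := (antipode HH).
Local Notation eps := (counit HH).

(** The axiom tests coassociativity on products of functionals only; [trilin_ext] carries it over to
    every trilinear map. *)
Lemma sum_coassoc (M : lmodType K) (F : H -> H -> H -> M) a : trilin F ->
  \sum_(p <- D a) \sum_(q <- D p.1) F q.1 q.2 p.2 =
  \sum_(p <- D a) \sum_(q <- D p.2) F p.1 q.1 q.2.
Proof.
move=> trF.
have := @trilin_ext _ _ _ F [seq (q, p.2) | p <- D a, q <- D p.1]
  [seq (p.1, q.1, q.2) | p <- D a, q <- D p.2] trF.
rewrite !big_allpairs_dep /=; apply=> f g h.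
rewrite !big_allpairs_dep /=.
transitivity (\sum_(p <- D a) ev2 f g (D p.1) * h p.2).
  by apply: eq_bigr => p _; rewrite mulr_suml.
rewrite cop_coassoc; apply: eq_bigr => p _; rewrite mulr_sumr.
by apply: eq_bigr => q _; rewrite mulrA.
Qed.

Lemma sum_cop_mul (M : lmodType K) (F : H -> H -> M) a b : bilin F ->
  \sum_(p <- D (a * b)) F p.1 p.2 =
  \sum_(p <- D a) \sum_(q <- D b) F (p.1 * q.1) (p.2 * q.2).
Proof. by move=> bF; rewrite (teq_bilin bF (cop_mul _ _ _)) big_allpairs_dep. Qed.

(** * The subspaces A and V and the correspondence between a and b *)

Variable Lt : H.
Hypothesis Lt0 : Lt != 0.
Local Notation V := (VL HH Lt).
Local Notation A := (AL HH Lt).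
(** Keeps visible the witness [b] that [AL] hides, because the antipode identities involve S(b). *)
Definition ALpair a b := teq (tmul_r (D a) Lt) [:: (b, Lt)].

Lemma ALpair_sum (M : lmodType K) (G : H -> H -> M) a b :
  bilin G -> ALpair a b -> \sum_(p <- D a) G p.1 (p.2 * Lt) = G b Lt.
Proof. by move=> bG /(teq_bilin bG); rewrite big_map big_seq1. Qed.

(* This is [(1 (x) a) D(Lt) = (S(b) (x) 1) D(Lt)]: expand
   [S(b) Lt_1 (x) Lt_2 = S(a_1) a_2 Lt_1 (x) a_3 Lt_2]. *)
Lemma ALpair_cop (M : lmodType K) (F : H -> H -> M) a b :
  bilin F -> ALpair a b ->
  \sum_(r <- D Lt) F r.1 (a * r.2) = \sum_(r <- D Lt) F (S b * r.1) r.2.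
Proof.
move=> bF ab; have [F1 F2] := bF.
pose G x z := \sum_(q <- D z) F (S x * q.1) q.2.
have bG : bilin G by rewrite /G; mlin.
rewrite -/(G b Lt) -(ALpair_sum bG ab) /G.
transitivity (\sum_(p <- D a) \sum_(q <- D p.2) \sum_(r <- D Lt)
     F (S p.1 * (q.1 * r.1)) (q.2 * r.2)); last first.
  apply: eq_bigr => p _; apply: esym.
  by apply: (sum_cop_mul (F := fun x y => F (S p.1 * x) y)); mlin.
rewrite -(sum_coassoc (F := fun x y z => \sum_(r <- D Lt) F (S x * (y * r.1)) (z * r.2)));
  last by mlin.
transitivity (\sum_(p <- D a) \sum_(r <- D Lt) eps p.1 *: F r.1 (p.2 * r.2)).
  rewrite exchange_big; apply: eq_bigr => r _ /=.
  have -> : a * r.2 = \sum_(p <- D a) eps p.1 *: (p.2 * r.2).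
    rewrite -{1}(counit_l HH a) mulr_suml.
    by apply: eq_bigr => p _; rewrite scalerAl.
  by rewrite (lin_sumZ _ _ _ (F2 _)).
apply: eq_bigr => p _; rewrite exchange_big; apply: eq_bigr => r _ /=.
rewrite -(linZ _ _ (F1 _)) -[eps _ *: r.1]mul1r -scalerAr scalerAl -antipode_l.
rewrite mulr_suml (lin_sum _ _ (F1 _)).
by apply: eq_bigr => q _; rewrite mulrA.
Qed.

(* The right-hand side is [a_1 nu(S(a_2) a_3 Lt)]. *)
Lemma ALpair_recover (nu : {scalar H}) a b : ALpair a b ->
  nu Lt *: a = \sum_(q <- D b) nu (S q.2 * Lt) *: q.1.
Proof.
move=> ab; pose G x z := \sum_(q <- D x) nu (S q.2 * z) *: q.1.
have bG : bilin G by rewrite /G; mlin.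
rewrite -/(G b Lt) -(ALpair_sum bG ab) /G.
transitivity (\sum_(p <- D a) \sum_(q <- D p.2) nu (S q.1 * (q.2 * Lt)) *: p.1);
  last first.
  by rewrite -(sum_coassoc (F := fun x y z => nu (S y * (z * Lt)) *: x)) //; mlin.
rewrite -{1}(counit_r HH a) scaler_sumr; apply: eq_bigr => p _.
rewrite -scaler_suml -linear_sum scalerA mulrC; congr (_ *: _).
rewrite -linearZ -[Lt in LHS]mul1r scalerAl -antipode_l mulr_suml.
by congr (nu _); apply: eq_bigr => q _; rewrite mulrA.
Qed.

Lemma ALpair_inj0 a : ALpair a 0 -> a = 0.
Proof.
move=> a0; have [nu nuLt] := exists_functional1 Lt0.
rewrite -[a]scale1r -nuLt (ALpair_recover nu a0).
apply: (@lin0 _ H H (fun b => \sum_(q <- D b) nu (S q.2 * Lt) *: q.1)).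
by lin.
Qed.

Lemma ALpair1 : ALpair 1 1.
Proof.
move=> f h; rewrite [LHS]big_map [RHS]big_seq1.
have := @teq_bilin K H K^o (fun x y => f x *: (h (y * Lt) : K^o)) _ _ _ (cop_one HH).
by rewrite big_seq1 mul1r; apply; mlin.
Qed.

Lemma ALpair_linear k a a' b b' : ALpair a b -> ALpair a' b' ->
  ALpair (k *: a + a') (k *: b + b').
Proof.
move=> ab ab' f h; rewrite [LHS]big_map [RHS]big_seq1 /=.
pose G x y : K^o := f x *: (h (y * Lt) : K^o).
have Gl : linear (fun a => \sum_(p <- D a) G p.1 p.2) by rewrite /G; lin.
have := ab' f h; have := ab f h; rewrite /ev2 !big_map !big_seq1 /= => abE abE'.
transitivity (k * (f b * h Lt) + f b' * h Lt); first by rewrite [LHS]Gl -abE -abE'.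
by rewrite linearP mulrDl -mulrA.
Qed.

Lemma AL_subspace : subspace A.
Proof.
split=> [|k y z [b ab] [c ac]]; last by exists (k *: b + c); apply: ALpair_linear.
(* The zero pair arises as -1 times the pair of [ALpair1] plus that pair. *)
exists 0; have := ALpair_linear (-1) ALpair1 ALpair1.
by rewrite scaleN1r addNr.
Qed.

Lemma VL_subspace : subspace V.
Proof.
split=> [|k _ _ [mu ->] [nu ->]].
  exists (scalar_of (f := fun=> 0) (fun k _ _ => esym (etrans (addr0 _) (mulr0 k)))).
  by rewrite /slice_l big1 // => p _; rewrite scalar_ofE scale0r.
have l : scalar (fun x => k * mu x + nu x).
  move=> c x y; rewrite !linearP !mulrDr addrACA; congr (_ + _ + _).
  by rewrite mulrCA.
exists (scalar_of l); rewrite /slice_l scaler_sumr -big_split.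
by apply: eq_bigr => p _; rewrite scalar_ofE scalerDl scalerA.
Qed.

Lemma VL_self : V Lt.
Proof. by exists eps; rewrite /slice_l counit_l. Qed.

Lemma functional_mull (nu : {scalar H}) b :
  exists mu : {scalar H}, forall x, mu x = nu (b * x).
Proof.
have l : scalar (fun x => nu (b * x)) by move=> k x y; rewrite mulrDr -scalerAr linearP.
by exists (scalar_of l).
Qed.

(** By [ALpair_cop], multiplying the slice along [nu] by [a] gives the slice along x |-> nu(S(b)
    x). *)
Lemma AL_mul_VL a v : A a -> V v -> V (a * v).
Proof.
move=> [b ab] [nu ->]; have [mu muE] := functional_mull nu (S b).
exists mu; rewrite /slice_l mulr_sumr.
under eq_bigr do rewrite -scalerAr; under [RHS]eq_bigr do rewrite muE.
by apply: (ALpair_cop (F := fun x y => nu x *: y) _ ab); mlin.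
Qed.

(* [a V = 0] means [S(b) Lt_1 (x) Lt_2 = 0], whence
   [S(b) Lt_1 S(Lt_2) (x) Lt_3 = S(b) (x) Lt = 0]. *)
Lemma ALpair_annihilator a b : ALpair a b -> (forall v, V v -> a * v = 0) -> a = 0.
Proof.
move=> ab aV; apply: ALpair_inj0; suff b0 : b = 0 by rewrite -{1}b0.
have [h hLt] := exists_functional1 Lt0.
apply: (bij_inj (antipode_bij HH)); rewrite linear0.
pose F x y := \sum_(q <- D y) h q.2 *: (x * S q.1).
have bF : bilin F by rewrite /F; mlin.
have aLt : teq [seq (p.1, a * p.2) | p <- D Lt] [::].
  move=> f g; rewrite [LHS]big_map [RHS]big_nil /=.
  transitivity (g (a * slice_l f (D Lt))); last by rewrite aV ?linear0 //; exists f.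
  rewrite /slice_l mulr_sumr linear_sum; apply: eq_bigr => p _.
  by rewrite -scalerAr linearZ.
have := teq_bilin bF aLt; rewrite big_map big_nil (ALpair_cop bF ab) /F.
move <-.
rewrite -(sum_coassoc (F := fun x y z => h z *: (S b * x * S y))); last by mlin.
transitivity (\sum_(p <- D Lt) h p.2 *: (eps p.1 *: S b)).
  rewrite -[LHS]scale1r -hLt -{1}(counit_l HH Lt) linear_sum scaler_suml.
  by apply: eq_bigr => p _; rewrite linearZ scalerA mulrC.
apply: eq_bigr => p _; rewrite -scaler_sumr; congr (_ *: _).
rewrite -[X in _ *: X]mulr1 scalerAr -antipode_r mulr_sumr.
by apply: eq_bigr => q _; rewrite mulrA.
Qed.

Lemma VL_dim : exists n, dim_le V n.
Proof.
exists (size (D Lt)); apply: (@span_dim_le _ _ _ _ (fun i => (nth (0, 0) (D Lt) i).2)).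
move=> v [nu ->]; exists (\row_i nu (nth (0, 0) (D Lt) i).1).
rewrite /slice_l (big_nth (0, 0)) big_mkord.
by apply: eq_bigr => i _; rewrite mxE.
Qed.

(* Left multiplication embeds A in End(V), by [ALpair_annihilator]. *)
Lemma AL_dim : exists n, dim_le A n.
Proof.
have [n Vn] := VL_dim; have [r [e [Ve _ es]]] := exists_basis VL_subspace Vn.
exists (r * r)%N => m a rm Aa.
have aE i k : exists c, a i * e k = comb e c by apply/es/AL_mul_VL.
have [c cE] := boolp.choice (fun ik => aE ik.1 ik.2).
(* [M i] represents left multiplication by [a i] on the span of [e]. Flattened, these are more than
   r^2 vectors of length r^2, hence dependent. *)
pose M i := \matrix_k c (i, k).
have [x x0 xM] := wide_kernel (\matrix_i mxvec (M i)) rm.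
exists x => //; have Aax : A (comb a x) by apply: subspace_sum => //; apply: AL_subspace.
have [b ab] := Aax; apply: (ALpair_annihilator ab) => v /es [d ->].
have xc k l : \sum_i x 0 i * c (i, k) 0 l = 0.
  transitivity ((x *m \matrix_i mxvec (M i)) 0 (mxvec_index k l)); last by rewrite xM mxE.
  by rewrite mxE; apply: eq_bigr => i _; rewrite [in RHS]mxE mxvecE mxE.
rewrite /comb mulr_sumr big1 // => k _; rewrite -scalerAr mulr_suml.
under eq_bigr do rewrite -scalerAl (cE (_, k)) /comb scaler_sumr.
rewrite exchange_big big1 ?scaler0 // => l _.
under eq_bigr do rewrite scalerA.
by rewrite -scaler_suml xc scale0r.
Qed.

(** * Elements of integral type: V lies in A *)

Section LIntegral.
Variable L : H.
Hypothesis LLt : Lintegral_type HH L Lt.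

(** Apply D to the first leg of D(Lt)(1 (x) Lt) = L (x) Lt, then [nu] to the new first leg;
    coassociativity identifies the left side. *)
Lemma VL_ALpair nu : ALpair (slice_l nu (D Lt)) (slice_l nu (D L)).
Proof.
move=> f h; rewrite [LHS]big_map [RHS]big_seq1 /=.
pose G x y : K^o := f x *: (h (y * Lt) : K^o).
have Gl : linear (fun a => \sum_(p <- D a) G p.1 p.2) by rewrite /G; lin.
rewrite [LHS](lin_sumZ _ _ _ Gl) /G.
transitivity (\sum_(p <- D Lt) \sum_(q <- D p.2)
   nu p.1 *: (f q.1 *: (h (q.2 * Lt) : K^o))).
  by apply: eq_bigr => p _; rewrite scaler_sumr.
rewrite -(sum_coassoc (F := fun x y z => nu x *: (f y *: (h (z * Lt) : K^o))));
  last by mlin.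
pose G' x z : K^o := \sum_(q <- D x) nu q.1 *: (f q.2 *: (h z : K^o)).
have bG' : bilin G' by rewrite /G'; mlin.
have := teq_bilin bG' (proj2 LLt); rewrite big_map big_seq1 => /= ->.
rewrite /G' linear_sum mulr_suml; apply: eq_bigr => p _.
by rewrite [f (_ *: _)]linearZ -mulrA.
Qed.

Lemma VL_AL a : V a -> A a.
Proof. by case=> nu ->; exists (slice_l nu (D L)); apply: VL_ALpair. Qed.

Lemma VL_eq_AL : V 1 -> forall a, V a <-> A a.
Proof.
move=> V1 a; split=> [/VL_AL//|Aa]; rewrite -[a]mulr1; exact: AL_mul_VL.
Qed.

(** * Cointegrals attached to a group-like element *)

Section Cointegral.
Variable g : H.
Hypothesis gg : group_like HH g.

Lemma counit_group_like : eps g = 1.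
Proof.
have [g0 /(@teq_bilin K H H (fun x y => eps x *: y))] := gg.
rewrite counit_l big_seq1 => /(_ _) gE.
have {gE} : g = eps g *: g by apply: gE; mlin.
move/eqP; rewrite -{1}[g]scale1r -subr_eq0 -scalerBl scaler_eq0 (negPf g0) orbF.
by rewrite subr_eq0 eq_sym => /eqP.
Qed.

Lemma group_like_antipode : g * S g = 1.
Proof.
have [_ /(@teq_bilin K H H (fun x y => x * S y))] := gg.
rewrite antipode_r big_seq1 counit_group_like scale1r => gE.
by rewrite -gE //; mlin.
Qed.

(** Both sides are (mu (x) nu) D(Lt). *)
Lemma slice_exchange (mu nu : {scalar H}) :
  nu (slice_l mu (D Lt)) = mu (slice_r nu (D Lt)).
Proof.
rewrite /slice_l /slice_r !linear_sum; apply: eq_bigr => p _.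
by rewrite !linearZ /= mulrC.
Qed.

Lemma cointegralE phi : cointegral HH V g phi -> slice_r phi (D Lt) = phi Lt *: g.
Proof. by apply; apply: VL_self. Qed.

(** Since V consists of slices of D(Lt), a cointegral is determined by its value at [Lt]; this is
    the source of uniqueness up to a scalar. *)
Lemma cointegral_slice phi mu : cointegral HH V g phi ->
  phi (slice_l mu (D Lt)) = phi Lt * mu g.
Proof. by move=> phig; rewrite slice_exchange cointegralE // linearZ. Qed.

Lemma cointegral_nonzero phi : cointegral HH V g phi ->
  nonzero_on V phi -> phi Lt != 0.
Proof.
move=> phig [_ [[mu ->]]]; rewrite cointegral_slice //.
by apply: contraNneq => ->; rewrite mul0r.
Qed.

(** Slicing the outer legs of the iterated coproduct of [Lt] by [mu] and [nu] gives (mu (x) id)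
    D(g), which is mu(g) g as [g] is group-like. *)
Lemma slice_cointegral (nu : {scalar H}) :
  g = slice_r nu (D Lt) -> cointegral HH V g nu.
Proof.
move=> gE _ [mu ->]; rewrite slice_exchange -gE.
have -> : slice_r nu (D (slice_l mu (D Lt))) = slice_l mu (D g).
  rewrite gE /slice_r (lin_sumZ (f := fun z => \sum_(p <- D z) nu p.2 *: p.1)); last by lin.
  rewrite /slice_l (lin_sumZ (f := fun z => \sum_(p <- D z) mu p.1 *: p.2)); last by lin.
  transitivity (\sum_(p <- D Lt) \sum_(q <- D p.2) mu p.1 *: (nu q.2 *: q.1)).
    by apply: eq_bigr => p _; rewrite scaler_sumr.
  rewrite -(sum_coassoc (F := fun x y z => mu x *: (nu z *: y))); last by mlin.
  apply: eq_bigr => p _; rewrite scaler_sumr; apply: eq_bigr => q _.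
  by rewrite !scalerA mulrC.
have [_ /(@teq_bilin K H H (fun x y => mu x *: y))] := gg.
by rewrite big_seq1; apply; mlin.
Qed.

(** Here [a] ranges over A but is tested only against V, so that the lemma applies to [v - 1] before
    1 is known to lie in V. *)
Lemma cointegral_faithful phi a : cointegral HH V g phi -> phi Lt != 0 ->
  A a -> (forall v, V v -> phi (a * v) = 0) -> a = 0.
Proof.
move=> phig phiLt [b ab] aV; apply: ALpair_inj0; suff b0 : b = 0 by rewrite -{1}b0.
apply: (bij_inj (antipode_bij HH)); rewrite linear0.
(* As g S(g) = 1, it is enough that S(b) g vanishes, which is then tested on every functional
   [mu]. *)
rewrite -[S b]mulr1 -group_like_antipode mulrA.
suff -> : S b * g = 0 by rewrite mul0r.
apply: functionals_separate => mu; rewrite linear0.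
apply: (mulfI phiLt); rewrite mulr0 -linearZ scalerAr -cointegralE //.
rewrite -[RHS](aV (slice_l mu (D Lt))); last by exists mu.
rewrite /slice_r /slice_l !mulr_sumr !linear_sum.
transitivity (\sum_(p <- D Lt) mu (S b * p.1) *: (phi p.2 : K^o)).
  by apply: eq_bigr => p _; rewrite -scalerAr [LHS]linearZ [LHS]mulrC.
rewrite -(ALpair_cop (F := fun x y => mu x *: (phi y : K^o)) _ ab); last by mlin.
by apply: eq_bigr => p _; rewrite -scalerAr [RHS]linearZ.
Qed.

Lemma bilin_mul (phi : {scalar H}) : bilin (fun x y : H => phi (x * y) : K^o).
Proof. by mlin. Qed.

Lemma cointegral_non_degenerate phi : cointegral HH V g phi -> phi Lt != 0 -> V 1.
Proof.
move=> phig phiLt; have [n Vn] := VL_dim.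
have Vl a : V a -> (forall v, V v -> phi (a * v) = 0) -> a = 0.
  by move=> /VL_AL; apply: cointegral_faithful.
have [v Vv vE] := functional_represented VL_subspace Vn (bilin_mul phi) Vl phi.
suff /eqP : v - 1 = 0 by rewrite subr_eq0 => /eqP <-.
apply: (cointegral_faithful phig phiLt).
  by apply: subspaceB; [apply: AL_subspace | apply: VL_AL | exists 1; apply: ALpair1].
by move=> x Vx; rewrite mulrBl mul1r linearB /= vE // subrr.
Qed.

(** If [phi] vanished on V, it would vanish on A Lt, and right nondegeneracy of phi(x y) on A would
    give Lt = 0. *)
Lemma faithful_AL_nonzero phi : faithful_on A phi -> nonzero_on V phi.
Proof.
move=> phif; have [n An] := AL_dim; apply: boolp.contrapT => phi0.
move/eqP: Lt0; apply.
apply: (right_nondegenerate AL_subspace An (bilin_mul phi)) => [||a Aa].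
- by move=> a Aa; apply: phif.
- exact/VL_AL/VL_self.
apply/eqP/negP => /negP phia; apply: phi0.
by exists (a * Lt); split=> //; apply: AL_mul_VL => //; apply: VL_self.
Qed.

End Cointegral.
End LIntegral.
End Hopf.

(** * Dimension, non-degeneracy, faithfulness and the converse *)

Theorem mainTheorem15 (K : fieldType) (H : algType K) (HH : hopf_algebra H)
    (L Lt g : H) :
  integral_type HH L -> Lintegral_type HH L Lt -> group_like HH g ->
  [/\ (* dim L^g_{V_Lt} = 1 if g in _Lt V *)
      (LV HH Lt g ->
         exists phi : {scalar H},
           cointegral HH (VL HH Lt) g phi /\ nonzero_on (VL HH Lt) phi /\
           forall psi : {scalar H}, cointegral HH (VL HH Lt) g psi ->
             exists c : K, forall a, VL HH Lt a -> psi a = c * phi a),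
      (* dim L^g_{V_Lt} = 0 otherwise *)
      (~ LV HH Lt g ->
         forall phi : {scalar H}, cointegral HH (VL HH Lt) g phi ->
           forall a, VL HH Lt a -> phi a = 0),
      (* nonzero cointegral => non-degenerate, V = A, phi faithful *)
      (forall phi : {scalar H}, cointegral HH (VL HH Lt) g phi ->
         nonzero_on (VL HH Lt) phi ->
         [/\ non_degenerate_integral HH Lt,
             (forall a, VL HH Lt a <-> AL HH Lt a)
           & faithful_on (VL HH Lt) phi])
    & (* converse *)
      ((exists phi : {scalar H},
          cointegral HH (AL HH Lt) g phi /\ faithful_on (AL HH Lt) phi) ->
       non_degenerate_integral HH Lt)].
Proof.
move=> _ LLt gg; have Lt0 := proj1 LLt.
have strong phi : cointegral HH (VL HH Lt) g phi -> nonzero_on (VL HH Lt) phi ->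
    [/\ non_degenerate_integral HH Lt, (forall a, VL HH Lt a <-> AL HH Lt a)
      & faithful_on (VL HH Lt) phi].
  move=> phig /(cointegral_nonzero phig) phiLt.
  have V1 := cointegral_non_degenerate Lt0 LLt gg phig phiLt.
  split=> // [|a /(VL_AL LLt)]; first exact: VL_eq_AL LLt V1.
  by move=> Aa; apply: (cointegral_faithful Lt0 gg phig phiLt Aa).
split=> //.
- move=> [nu gE]; have nug := slice_cointegral gg gE.
  (* Evaluating eps (x) nu on D(Lt) gives both nu(Lt) and eps(g) = 1. With this normalisation the
     ratio of [psi] to [nu] is [psi Lt]. *)
  have nuLt : nu Lt = 1.
    by rewrite -(counit_group_like gg) gE -slice_exchange /slice_l counit_l.
  exists nu; split=> //; split.
    by exists Lt; rewrite nuLt oner_eq0; split=> //; apply: VL_self.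
  move=> psi psig; exists (psi Lt) => _ [mu ->].
  by rewrite (cointegral_slice mu psig) (cointegral_slice mu nug) nuLt mul1r.
- move=> ng phi phig a Va; apply/eqP/negP => /negP phia; apply: ng.
  have phiLt : phi Lt != 0 by apply: (cointegral_nonzero phig); exists a.
  (* By [cointegralE], slicing D(Lt) along [phi] divided by [phi Lt] returns [g]. *)
  have l : scalar (fun x => (phi Lt)^-1 * phi x).
    by move=> k x y; rewrite linearP mulrDr mulrCA.
  exists (scalar_of l); rewrite -[LHS]scale1r -(mulVf phiLt) -scalerA -(cointegralE phig).
  by rewrite /slice_r scaler_sumr; apply: eq_bigr => p _; rewrite scalerA.
case=> phi [phig phif].
have phiV : cointegral HH (VL HH Lt) g phi by move=> a /(VL_AL LLt); apply: phig.
by case: (strong phi phiV (faithful_AL_nonzero Lt0 LLt phif)).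
Qed.
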